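(* Let $(R, \mathfrak{m}, \mathbb{F}_q)$ be a complete Noetherian local ring with finite residue field $\mathbb{F}_q$, and fix $u \in \mathbb{Z}_{\geq 0}$ and $n \in \mathbb{Z}_{\geq 1}$. Let $G$ be a finite $R$-module with Betti numbers $b_i := \beta_i^R(G)$. Then there exists $X \in \mathrm{M}_{n \times (n+u)}(R)$ with $\mathrm{cok}(X) \simeq_R G$ if and only if $n \geq b_0 \geq b_1 - u$. Moreover, with respect to the Haar measure on $\mathrm{M}_{n\times(n+u)}(R)$, \[\mathrm{Prob}\big(\mathrm{cok}(X) \simeq_R G\big) = \frac{1}{|\mathrm{Aut}_R(G)|\,|G|^u} \prod_{i = u + b_0 - b_1 + 1}^{n+u}(1 - q^{-i}) \prod_{j = n - b_0 + 1}^{n}(1 - q^{-j})\] if $n \geq b_0 \geq b_1 - u$, and the probability is $0$ otherwise.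
   Context: For a Noetherian local ring $(R,\mathfrak m,\kappa)$ and finitely generated $R$-module $G$, the Betti number is $\beta_i^R(G) := \dim_\kappa \mathrm{Tor}_i^R(G,\kappa)$ (equivalently the rank of the $i$-th free module in a minimal free resolution; $\beta_0^R(G)$ is the minimal number of generators). For $X \in \mathrm{M}_{n\times m}(R)$, $\mathrm{cok}(X) = R^n / X R^m$. *)

(* Defs.v *)
From HB Require Import structures.
From mathcomp Require Import all_boot all_order perm all_algebra.
From mathcomp Require Import all_classical all_reals all_analysis.

Set Implicit Arguments.
Unset Strict Implicit.
Unset Printing Implicit Defensive.

Import Order.TTheory GRing.Theory Num.Theory.

Local Open Scope classical_set_scope.
Local Open Scope ring_scope.
Local Open Scope quotient_scope.

(* Ideals are [set R] rather than the boolean [idealr] of ring_quotient, which *)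
(* excludes the unit ideal.                                                    *)
Section Ideals.
Variable R : comNzRingType.
Implicit Types I m : set R.

Definition is_ideal I : Prop :=
  I 0 /\ forall a x y, I x -> I y -> I (a * x + y).

Definition ideal_gen (A : set R) : set R := smallest is_ideal A.

Fixpoint ideal_pow I (k : nat) : set R :=
  if k is k'.+1 then
    ideal_gen [set z | exists x y, [/\ I x, ideal_pow I k' y & z = x * y]]
  else setT.

Definition noetherian : Prop :=
  forall I, is_ideal I -> exists A, finite_set A /\ I = ideal_gen A.

Definition is_maximal_ideal I : Prop :=
  [/\ is_ideal I, I != setT &
      forall J, is_ideal J -> I `<=` J -> J != setT -> J = I].

Definition local_ring m : Prop :=
  forall I, is_maximal_ideal I <-> I = m.

(* The canonical map from R to the inverse limit of the R / m ^ k is           *)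
(* bijective; in particular R is m-adically separated.                         *)
Definition adically_complete m : Prop :=
  forall x : nat -> R,
    (forall k, ideal_pow m k (x k.+1 - x k)) ->
    exists! l, forall k, ideal_pow m k (l - x k).

(* rho identifies kappa with the residue field R / m.                          *)
Definition residue_map m (kappa : fieldType) (rho : {rmorphism R -> kappa}) :
  Prop := set_surj setT setT rho /\ m = rho @^-1` [set 0].

End Ideals.

Section Cokernel.
Variables (R : comNzRingType) (n k : nat) (X : 'M[R]_(n, k)).

Definition colspan : {pred 'cV[R]_n} :=
  fun y => `[< exists v : 'cV[R]_k, y = X *m v >].

Lemma colspan_zmod_closed : zmod_closed colspan.
Proof.
split; first by apply/asboolP; exists 0; rewrite mulmx0.
move=> _ _ /asboolP[v ->] /asboolP[w ->].
by apply/asboolP; exists (v - w); rewrite mulmxBr.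
Qed.

HB.instance Definition _ :=
  GRing.isZmodClosed.Build _ colspan colspan_zmod_closed.

Definition cok : Type := Quotient.quot colspan.

HB.instance Definition _ := GRing.Zmodule.on cok.
HB.instance Definition _ := ZmodQuotient.on cok.

Definition cok_scale (a : R) (y : cok) : cok := \pi_cok (a *: repr y).

Lemma pi_cok_scale a (y : 'cV[R]_n) : cok_scale a (\pi_cok y) = \pi_cok (a *: y).
Proof.
apply/eqP; rewrite -Quotient.idealrBE -scalerBr.
have : repr (\pi_cok y) - y \in colspan by rewrite Quotient.idealrBE reprK.
move=> /asboolP[v ->]; apply/asboolP; exists (a *: v).
by rewrite scalemxAr.
Qed.

Lemma cok_scaleA a b (y : cok) : cok_scale a (cok_scale b y) = cok_scale (a * b) y.
Proof. by rewrite -[y]reprK (pi_cok_scale b) !pi_cok_scale scalerA. Qed.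

Lemma cok_scale1 : left_id 1 cok_scale.
Proof. by move=> y; rewrite -[y]reprK pi_cok_scale scale1r. Qed.

Lemma cok_scaleDr : right_distributive cok_scale +%R.
Proof.
move=> a y z; rewrite -[y]reprK -[z]reprK.
by rewrite -[in LHS]pi_addr !pi_cok_scale scalerDr pi_addr.
Qed.

Lemma cok_scaleDl (y : cok) : {morph cok_scale^~ y : a b / a + b}.
Proof.
by move=> a b; rewrite -[y]reprK !pi_cok_scale scalerDl pi_addr.
Qed.

HB.instance Definition _ := GRing.Zmodule_isLmodule.Build R cok
  cok_scaleA cok_scale1 cok_scaleDr cok_scaleDl.

End Cokernel.

Definition lmod_iso (R : comNzRingType) (U V : lmodType R) : Prop :=
  exists f : {linear U -> V}, bijective f.

Definition lmod_Aut (R : comNzRingType) (G : finLmodType R) : {set {perm G}} :=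
  [set s : {perm G} | `[< linear (s : G -> G) >]]%SET.

(* A resolution ... -> R^(rk 2) -> R^(rk 1) -> R^(rk 0) -> G -> 0; matrices    *)
(* act on column vectors.                                                      *)
Record free_resolution (R : comNzRingType) (G : lmodType R) := FreeResolution {
  res_rk : nat -> nat;
  res_diff : forall i, 'M[R]_(res_rk i, res_rk i.+1);
  res_aug : {linear 'cV[R]_(res_rk 0) -> G};
  res_aug_surj : set_surj setT setT res_aug;
  res_exact0 : forall v : 'cV[R]_(res_rk 0),
    res_aug v = 0 <-> exists w, v = res_diff 0 *m w;
  res_exactS : forall i (v : 'cV[R]_(res_rk i.+1)),
    res_diff i *m v = 0 <-> exists w, v = res_diff i.+1 *m w }.

Section Betti.
Variables (R : comNzRingType) (kappa : fieldType).
Variables (rho : {rmorphism R -> kappa}) (G : lmodType R).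

(* Dimension of Tor_i(G, kappa) = H_i(F (x) kappa): F (x) kappa consists of    *)
(* the spaces kappa^(rk i), with the differentials of F reduced by rho.        *)
(* Transposed because kermx is a kernel on row vectors.                        *)
Definition tor_dim (F : free_resolution G) (i : nat) : nat :=
  let D j := map_mx rho (res_diff F j) in
  ((if i is j.+1 then \rank (kermx (D j)^T) else res_rk F 0) - \rank (D i))%N.

(* Tor does not depend on the resolution; one by finite free modules exists    *)
(* when R is noetherian and G is finitely generated.                           *)
Definition betti (i : nat) : nat :=
  get [set b | exists F : free_resolution G, b = tor_dim F i].

End Betti.

Section Haar.
Variables (R : comNzRingType) (m : set R) (n k : nat).

(* A copy of 'M[R]_(n, k), pointed as measurable types require.                *)
Definition adic_matrix : Type := 'M[R]_(n, k).
HB.instance Definition _ := GRing.Zmodule.on adic_matrix.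
HB.instance Definition _ := isPointed.Build adic_matrix 0.

(* The product of the m-adic topologies on the entries.                        *)
Definition adic_open (U : set adic_matrix) : Prop :=
  forall X : 'M[R]_(n, k), U X -> exists e : nat,
    forall Y : 'M[R]_(n, k), (forall i j, ideal_pow m e (Y i j - X i j)) -> U Y.

Definition adic_borel := g_sigma_algebraType adic_open.
HB.instance Definition _ := Pointed.on adic_borel.
HB.instance Definition _ : @Measurable (sigma_display adic_open) adic_borel :=
  Measurable.on (g_sigma_algebraType adic_open).

(* For R / m finite and R complete and noetherian, the matrix group is compact *)
(* and metrizable, so its normalized Haar measure is the translation-invariant *)
(* Borel probability.                                                          *)
Definition is_haar (K : realType) (mu : probability adic_borel K) : Prop :=
  forall (A : set adic_borel) (X : 'M[R]_(n, k)), measurable A ->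
    mu [set X + (Y : 'M[R]_(n, k)) | Y in A] = mu A.

End Haar.

(* Main.v *)
Require Import Defs.
From HB Require Import structures.
From mathcomp Require Import all_boot all_order perm all_algebra.
From mathcomp Require Import all_classical all_reals all_analysis.
From mathcomp Require Import measurable_realfun zify ring.

Set Implicit Arguments.
Unset Strict Implicit.
Unset Printing Implicit Defensive.

Import Order.TTheory GRing.Theory Num.Theory.

Local Open Scope classical_set_scope.
Local Open Scope ring_scope.

(* The cokernel of X is isomorphic to G exactly when the image of X is the     *)
(* kernel of some surjection t : R^n -> G, and Aut(G) permutes simply          *)
(* transitively the surjections with a given kernel.  Hence                    *)
(*   |Aut G| mu(E) = sum over surjections t of mu{X : im X = ker t}.           *)
(* By comparison with a minimal presentation of G, ker t is minimally          *)
(* generated by r = n - b0 + b1 elements.  The columns of X lie in ker t with  *)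
(* probability |G|^-(n+u), and they then generate it iff the matrix of their   *)
(* reductions, uniform in the r x (n+u) matrices over the residue field, has   *)
(* rank r.  The same criterion, applied to G, counts the surjections t.  All   *)
(* the probabilities come from homomorphisms with open kernel to finite        *)
(* groups, whose fibres have equal measure by translation invariance.          *)

(** The algebra rests on Nakayama's lemma in matrix form, [minimal_factor_rank]: a map that factors
    through a minimal [g] by a matrix [Z] has the same image as [g] iff [Z] has full row rank over
    [kappa]. Combined with a count in the spirit of Schanuel's lemma, [minimal_kernel_rank], it
    shows that the kernel of every surjection from R^n onto G needs exactly n - b0 + b1 generators.
    This settles existence ([presents_existsP]), while [bettiE] identifies b0 and b1 with the sizes
    of a minimal presentation.

    The measure theory rests on [haar_preimset]: a homomorphism with open kernel, from a subgroup
    onto a finite group, carries Haar measure to a multiple of counting measure. Thus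
    [haar_presents] turns the probability of im X = ker t into a proportion of full-rank matrices,
    known from [card_row_free], and [card_generators] counts the surjections t in the same way. By
    [cok_iso_presents] and [card_presents], each X with cokernel G is counted |Aut G| times in the
    sum over t, and [measure_double_count] integrates this identity. *)

Section LocalAlgebra.
Variables (R : comNzRingType) (kappa : fieldType) (rho : {rmorphism R -> kappa}).
Hypothesis rho_surj : forall x, exists a, rho a = x.
Hypothesis rho_unit : forall a, rho a != 0 -> exists b, b * a = 1.

Local Notation red := (map_mx rho).

Lemma mx_lift p q (B : 'M[kappa]_(p, q)) : exists A : 'M[R]_(p, q), red A = B.
Proof.
have [f fK] := choice rho_surj.
by exists (\matrix_(i, j) f (B i j)); apply/matrixP => i j; rewrite !mxE fK.
Qed.

(** The determinant reduces to 1, hence is a unit, and the adjugate gives an inverse. *)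
Lemma mulmx_inv_of_red p (Z : 'M[R]_p) : red Z = 1%:M -> exists W, Z *m W = 1%:M.
Proof.
move=> Z1; have /rho_unit[c cZ] : rho (\det Z) != 0.
  by rewrite -det_map_mx Z1 det1 oner_eq0.
by exists (c *: \adj Z); rewrite -scalemxAr mul_mx_adj scale_scalar_mx cZ.
Qed.

Lemma mulmx_inv_of_rank p q (Z : 'M[R]_(p, q)) :
  \rank (red Z) = p -> exists W, Z *m W = 1%:M.
Proof.
move=> Zp; have /row_freeP[B ZB] : row_free (red Z) by rewrite /row_free Zp.
have [W WB] := mx_lift B.
have [V ZV] : exists V, Z *m W *m V = 1%:M.
  by apply: mulmx_inv_of_red; rewrite map_mxM WB.
by exists (W *m V); rewrite mulmxA.
Qed.

Lemma rank_red_of_inv p q (Z : 'M[R]_(p, q)) W :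
  red (Z *m W) = 1%:M -> \rank (red Z) = p.
Proof.
rewrite map_mxM => ZW; apply/eqP/row_freeP; by exists (red W).
Qed.

Lemma linear_cVE (N : lmodType R) k (g : {linear 'cV[R]_k -> N}) v :
  g v = \sum_j v j 0 *: g (delta_mx j 0).
Proof.
rewrite {1}(matrix_sum_delta v) linear_sum; apply: eq_bigr => i _.
by rewrite big_ord1 linearZ.
Qed.

(** Projectivity of R^k: lift the image of each basis vector through [g]. *)
Lemma linear_factor (N : lmodType R) r k (g : {linear 'cV[R]_r -> N})
    (s : {linear 'cV[R]_k -> N}) :
  range s `<=` range g -> exists Z, forall v, s v = g (Z *m v).
Proof.
move=> sg.
have sg_delta j : exists w, g w = s (delta_mx j 0).
  by have [|w _ <-] := sg (s (delta_mx j 0)); [exists (delta_mx j 0)|exists w].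
have [z zE] := choice sg_delta.
exists (\matrix_(i, j) z j i 0) => v.
rewrite (linear_cVE s) [RHS](linear_cVE (g \o mulmx (\matrix_(i, j) z j i 0))).
apply: eq_bigr => j _; congr (_ *: _); rewrite -zE /=; congr (g _).
by rewrite -colE; apply/matrixP => i l; rewrite !mxE ord1.
Qed.

(** No relation between the images of the basis vectors has a unit coefficient, so these images
    generate the range of [g] minimally. *)
Definition minimal_map (N : lmodType R) r (g : 'cV[R]_r -> N) :=
  forall v, g v = 0 -> red v = 0.

(** A generator with a unit coefficient in some relation is redundant; drop such generators until
    none is left. *)
Lemma minimal_map_exists (N : lmodType R) k (s : {linear 'cV[R]_k -> N}) :
  exists r (g : {linear 'cV[R]_r -> N}), minimal_map g /\ range g = range s.
Proof.
elim: k s => [|k IHk] s.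
  by exists 0%N, s; split=> // v _; apply/matrixP => -[].
have [s_min|] := pselect (minimal_map s); first by exists k.+1, s.
rewrite /minimal_map -existsNP => -[v]; rewrite not_implyP => -[sv0 /eqP v_neq0].
have [i /rho_unit[c cv]] : exists i, rho (v i 0) != 0.
  apply: contrapT => /forallNP v0; move/eqP: v_neq0; apply; apply/matrixP => i j.
  by rewrite ord1 !mxE; apply/eqP; move: (v0 i) => /negP; rewrite negbK.
have [r [g [g_min gE]]] := IHk (s \o mulmx (col' i 1%:M)).
exists r, g; split=> //; rewrite gE; apply/seteqP; split=> [_ [w _ <-]|_ [w _ <-]] /=.
  by exists (col' i 1%:M *m w).
(* Subtracting a multiple of the relation [v] clears coordinate [i] without changing the image under
   [s]. *)
set y := w - (w i 0 * c) *: v.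
have yi0 : y i 0 = 0 by rewrite !mxE -mulrA cv mulr1 subrr.
exists (row' i y) => //.
have -> : col' i 1%:M *m row' i y = y.
  apply/matrixP => a b; rewrite ord1 -[in RHS](mul1mx y) !mxE.
  rewrite (bigD1_ord i) //= yi0 mulr0 add0r.
  by apply: eq_bigr => j _; rewrite !mxE.
by rewrite /y linearB linearZ /= sv0 scaler0 subr0.
Qed.

(** Nakayama's lemma. If the ranges agree, [g] factors back through [s] by some [Y], so g = g Z Y,
    and minimality forces Z Y to reduce to the identity. Conversely, a right inverse over [kappa]
    lifts to one over [R]. *)
Lemma minimal_factor_rank (N : lmodType R) r k (g : {linear 'cV[R]_r -> N})
    (s : {linear 'cV[R]_k -> N}) (Z : 'M[R]_(r, k)) :
  minimal_map g -> (forall v, s v = g (Z *m v)) ->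
  range s = range g <-> \rank (red Z) = r.
Proof.
move=> g_min sZ; split=> [sg|/mulmx_inv_of_rank[W ZW]].
  have [|Y gY] := @linear_factor N k r s g; first by rewrite sg.
  apply: (@rank_red_of_inv _ _ Z Y); apply/trmx_inj/row_matrixP => i.
  rewrite -!tr_col !colE; congr trmx.
  have -> : delta_mx i 0 = red (delta_mx i 0) :> 'cV_r.
    by apply/matrixP => a b; rewrite !mxE rmorph_nat.
  rewrite -(map_mx1 rho) -!map_mxM; apply/eqP; rewrite -subr_eq0 -raddfB; apply/eqP.
  by apply: g_min; rewrite linearB /= -mulmxA -sZ -gY mul1mx subrr.
apply/seteqP; split=> [_ [v _ <-]|_ [v _ <-]]; first by exists (Z *m v).
by exists (W *m v) => //; rewrite sZ mulmxA ZW mul1mx.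
Qed.

(* The columns of [D] span the reductions of the syzygies of [s].  A syzygy    *)
(* modulo the maximal ideal lifts to a true one: if [s v] has coefficients in  *)
(* the maximal ideal on minimal generators, correct [v] by [Y *m (Z *m v)].    *)
Lemma minimal_syzygy_rank (N : lmodType R) r k l (g : {linear 'cV[R]_r -> N})
    (s : {linear 'cV[R]_k -> N}) (D : 'M[kappa]_(k, l)) :
  minimal_map g -> range s = range g ->
  (forall v, s v = 0 -> exists w, red v = D *m w) ->
  (forall w, exists2 v, s v = 0 & red v = D *m w) ->
  (r + \rank D)%N = k.
Proof.
move=> g_min sg sD Ds.
have [|Z sZ] := @linear_factor N r k g s; first by rewrite sg.
have [|Y gY] := @linear_factor N k r s g; first by rewrite sg.
have rZ : \rank (red Z) = r by apply/(minimal_factor_rank g_min sZ).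
have ZD : (red Z *m D) = 0.
  apply/trmx_inj/row_matrixP => i; rewrite -!tr_col !colE mul0mx -mulmxA.
  have [v sv0 <-] := Ds (delta_mx i 0).
  by rewrite -map_mxM g_min // -sZ.
(* The columns of [D] span the whole kernel of [red Z], which has dimension k - r. *)
have kerD : (kermx (red Z)^T == D^T)%MS.
  apply/andP; split.
    apply/row_subP => i; set x := row i _.
    have /(congr1 trmx) : x *m (red Z)^T = 0 by rewrite -row_mul mulmx_ker row0.
    rewrite trmx_mul trmxK trmx0.
    have [v vx] := mx_lift x^T; rewrite -vx -map_mxM => Zv0.
    have [|w] := sD (v - Y *m (Z *m v)); first by rewrite linearB /= -gY -sZ subrr.
    rewrite raddfB /= (map_mxM _ Y) Zv0 mulmx0 subr0 vx => /(congr1 trmx).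
    by rewrite trmxK trmx_mul => ->; exact: submxMl.
  by apply/sub_kermxP; rewrite -trmx_mul ZD trmx0.
move: (eqmx_rank kerD); rewrite mxrank_ker !mxrank_tr rZ => <-.
by rewrite subnKC // -rZ rank_leq_col.
Qed.

(* A right inverse [C] of the lift [B] of [f] through [f0] splits the kernel of *)
(* [f], which is generated by the columns of [C A0] and [1 - C B].             *)
Lemma minimal_kernel_rank (N : lmodType R) b r0 n r
    (f0 : {linear 'cV[R]_b -> N}) (A0 : 'M[R]_(b, r0))
    (f : {linear 'cV[R]_n -> N}) (A : 'M[R]_(n, r)) :
  minimal_map f0 -> range f = range f0 ->
  minimal_map (mulmx A0) -> range (mulmx A0) = [set v | f0 v = 0] ->
  minimal_map (mulmx A) -> range (mulmx A) = [set v : 'cV_n | f v = 0] ->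
  (r + b = r0 + n)%N.
Proof.
move=> f0_min ff0 A0_min A0E A_min AE.
have [|B fB] := @linear_factor N b n f0 f; first by rewrite ff0.
have /mulmx_inv_of_rank[C BC] := proj1 (minimal_factor_rank f0_min fB) ff0.
pose S : 'M[R]_(n, r0 + n) := row_mx (C *m A0) (1%:M - C *m B).
(* The syzygies of [S] reduce to the reductions of the vectors (0, C w); these form a space of
   dimension [b]. *)
pose D : 'M[kappa]_(r0 + n, b) := col_mx 0 (red C).
have BS : B *m S = row_mx A0 0.
  by rewrite mul_mx_row mulmxA BC mul1mx mulmxBr mulmx1 mulmxA BC mul1mx subrr.
have DB : \rank D = b.
  apply/eqP; rewrite -mxrank_tr; apply/row_freeP; exists (row_mx 0 (red B))^T.
  by rewrite -trmx_mul mul_row_col mul0mx add0r -map_mxM BC map_mx1 trmx1.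
rewrite -[X in (r + X)%N]DB.
apply: (@minimal_syzygy_rank _ r _ b (mulmx A) (mulmx S)) => //=.
- rewrite AE; apply/seteqP; split=> [_ [v _ <-]|v /= fv0] /=.
    rewrite fB mulmxA BS -[v]vsubmxK mul_row_col mul0mx addr0.
    have : [set v | f0 v = 0] (A0 *m usubmx v) by rewrite -A0E; exists (usubmx v).
    by [].
  have : [set v | f0 v = 0] (B *m v) by rewrite /= -fB.
  rewrite -A0E => -[w _ wE]; exists (col_mx w v) => //.
  by rewrite mul_row_col -mulmxA wE mulmxBl mul1mx -mulmxA addrC subrK.
- move=> v Sv0; exists (red (B *m dsubmx v)).
  have A0v : A0 *m usubmx v = 0.
    move: (congr1 (mulmx B) Sv0).
    by rewrite mulmxA BS -[v]vsubmxK mul_row_col mul0mx addr0 mulmx0 col_mxKu.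
  move: Sv0; rewrite -{1}[v]vsubmxK mul_row_col -mulmxA A0v mulmx0 add0r mulmxBl mul1mx.
  move/eqP; rewrite subr_eq0 => /eqP vE.
  rewrite -{1}[v]vsubmxK map_col_mx (A0_min _ A0v) {1}vE mul_col_mx mul0mx.
  by rewrite -mulmxA !map_mxM.
- move=> w; have [v <-] := mx_lift w; exists (col_mx 0 (C *m v)).
    by rewrite mul_row_col mulmx0 add0r mulmxBl mul1mx -mulmxA (mulmxA B) BC mul1mx subrr.
  by rewrite map_col_mx map_mx0 mul_col_mx mul0mx map_mxM.
Qed.

End LocalAlgebra.

(** * Finite generation, resolutions and Betti numbers *)

Section Noetherian.
Variable R : comNzRingType.
Hypothesis R_noetherian : noetherian R.

Lemma ideal_gen_ideal (A : set R) : is_ideal (ideal_gen A).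
Proof.
split=> [I [[I0 _] _] //|a x y Ax Ay I [II AI]].
by apply: II.2; [apply: Ax|apply: Ay].
Qed.

Lemma ideal_gen_sub (A I : set R) : is_ideal I -> A `<=` I -> ideal_gen A `<=` I.
Proof. by move=> II AI x; apply. Qed.

Lemma sub_ideal_gen (A : set R) : A `<=` ideal_gen A.
Proof. by move=> x Ax I [_]; apply. Qed.

Lemma submodule_sum (V : lmodType R) (S : set V) k (c : 'I_k -> R) (x : 'I_k -> V) :
  S 0 -> (forall a y z, S y -> S z -> S (a *: y + z)) ->
  (forall i, S (x i)) -> S (\sum_i c i *: x i).
Proof.
move=> S0 SD Sx; elim/big_ind: _ => // [y z Sy Sz|i _].
  by rewrite -[y]scale1r; apply: SD.
by rewrite -[_ *: _]addr0; apply: SD.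
Qed.

Lemma ideal_fg (I : set R) : is_ideal I ->
  exists k (a : 'I_k -> R), I = range (fun v : 'I_k -> R => \sum_i v i * a i).
Proof.
move=> II; have [A [/finite_seqP[s ->] IE]] := R_noetherian II.
exists (size s), (fun i => s`_i); apply/seteqP; split; last first.
  move=> _ [v _ <-]; apply: (@submodule_sum R^o) => [||i]; [exact: II.1|exact: II.2|].
  by rewrite IE; apply: sub_ideal_gen => /=; rewrite mem_nth.
rewrite IE; apply: ideal_gen_sub => [|x /= /(nthP 0)[i ilt <-]].
  split=> [|b _ _ [v _ <-] [w _ <-]].
    by exists (fun=> 0) => //; apply: big1 => i _; rewrite mul0r.
  exists (fun i => b * v i + w i) => //.
  rewrite mulr_sumr -big_split /=; apply: eq_bigr => i _.
  by rewrite mulrDl mulrA.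
exists (fun j => (j == Ordinal ilt)%:R) => //.
by rewrite (bigD1 (Ordinal ilt)) //= eqxx mul1r big1 ?addr0 // => j /negPf ->; rewrite mul0r.
Qed.

(** The first coordinates of [S] form a finitely generated ideal. Lifts of its generators, with
    generators of the submodule where the first coordinate vanishes (induction), generate [S]. *)
Lemma submodule_fg n (S : set 'cV[R]_n) :
  S 0 -> (forall a x y, S x -> S y -> S (a *: x + y)) ->
  exists k (A : 'M[R]_(n, k)), range (mulmx A) = S.
Proof.
elim: n S => [|n IHn] S S0 SD.
  exists 0%N, 0; apply/seteqP; split=> [v _|v _].
    by have -> : v = 0 by apply/matrixP => -[].
  by exists 0 => //; apply/matrixP => -[].
have SB x y : S x -> S y -> S (y - x) by move=> Sx Sy; rewrite addrC -scaleN1r; apply: SD.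
have [|k [a aE]] := @ideal_fg [set x ord0 0 | x in S].
  split=> [|b _ _ [x Sx <-] [y Sy <-]]; first by exists 0; rewrite ?mxE.
  by exists (b *: x + y); [apply: SD|rewrite !mxE].
have ax j : exists x, S x /\ x ord0 0 = a j.
  have : range (fun v : 'I_k -> R => \sum_i v i * a i) (a j).
    exists (fun i => (i == j)%:R) => //.
    by rewrite (bigD1 j) //= eqxx mul1r big1 ?addr0 // => i /negPf ->; rewrite mul0r.
  by rewrite -aE => -[x Sx <-]; exists x.
have [x /all_and2[Sx xE]] := choice ax.
have [||l [A AE]] := IHn [set y | S (col_mx (0 : 'cV_1) y)].
- by rewrite /= col_mx0.
- move=> b y z /= Sy Sz.
  have -> : col_mx (0 : 'cV_1) (b *: y + z) = b *: col_mx 0 y + col_mx 0 z.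
    by rewrite scale_col_mx add_col_mx scaler0 addr0.
  exact: SD.
have xS (v : 'I_k -> R) : S (\sum_i v i *: x i) by apply: submodule_sum.
have xM (v : 'cV_k) : \sum_i v i 0 *: x i = (\matrix_(i, j) x j i 0) *m v.
  apply/matrixP => i j; rewrite ord1 !mxE summxE; apply: eq_bigr => h _.
  by rewrite !mxE mulrC.
pose A' : 'M[R]_(n.+1, l) := col_mx (0 : 'M[R]_(1, l)) A.
have A'M (w : 'cV_l) : A' *m w = col_mx (0 : 'cV_1) (A *m w).
  by apply: etrans (mul_col_mx (0 : 'M[R]_(1, l)) A w) _; rewrite mul0mx.
exists (k + l)%N, (row_mx (\matrix_(i, j) x j i 0) A').
apply/seteqP; split=> [_ [v _ <-]|y Sy].
  rewrite -[v]vsubmxK mul_row_col -xM A'M addrC -[X in S (X + _)]scale1r.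
  apply: SD => //; have : range (mulmx A) (A *m dsubmx v) by exists (dsubmx v).
  by rewrite AE.
have : [set x ord0 0 | x in S] (y ord0 0) by exists y.
rewrite aE => -[v _ vE]; pose w : 'cV_k := \col_i v i.
pose z : 'cV_n.+1 := y - \sum_i v i *: x i.
have zE : z = col_mx (0 : 'cV_1) (dsubmx (z : 'cV_(1 + n))).
  have z0 : usubmx (z : 'cV_(1 + n)) = 0; last by rewrite -z0 (@vsubmxK R 1 n 1 z).
  apply/matrixP => i j.
  rewrite !ord1 !mxE (_ : lshift n 0 = ord0); last exact: val_inj.
  by rewrite summxE -vE; apply/eqP; rewrite subr_eq0; apply/eqP/eq_bigr => h _; rewrite !mxE xE.
have : [set y | S (col_mx (0 : 'cV_1) y)] (dsubmx (z : 'cV_(1 + n))).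
  by rewrite /= -zE; apply: SB.
rewrite -AE => -[w' _ w'E]; exists (col_mx w w') => //.
rewrite mul_row_col -xM A'M w'E -zE /z.
under eq_bigr do rewrite mxE.
by rewrite addrC subrK.
Qed.

Lemma kernel_fg (N : lmodType R) n (f : {linear 'cV[R]_n -> N}) :
  exists k (A : 'M[R]_(n, k)), range (mulmx A) = [set v | f v = 0].
Proof.
apply: submodule_fg => [|a x y /= fx fy]; first exact: linear0.
by rewrite linearP fx fy scaler0 addr0.
Qed.

Lemma free_resolution_exists (G : lmodType R) n (f : {linear 'cV[R]_n -> G}) :
  range f = setT -> inhabited (free_resolution G).
Proof.
move=> fT.
have rangeP p q (d : 'M[R]_(p, q)) (S : set 'cV_p) : range (mulmx d) = S ->
    forall v, S v <-> exists w, v = d *m w.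
  by move=> <- v; split=> [[w _ <-]|[w ->]]; exists w.
(* The state of the iteration packs a differential with its sizes, so that consecutive ranks match
   by computation. *)
pose st := {p : nat * nat & 'M[R]_(p.1, p.2)}.
have next (s : st) : {l & {d : 'M[R]_((tag s).2, l) |
    forall v : 'cV_(tag s).2, tagged s *m v = 0 <-> exists w, v = d *m w}}.
  have [l /cid[d dE]] := cid (kernel_fg (mulmx (tagged s))).
  by exists l, d; exact: (rangeP _ _ _ _ dE).
have [k0 [d0 d0E]] := kernel_fg f.
pose step (s : st) : st :=
  existT (fun p => 'M[R]_(p.1, p.2)) ((tag s).2, tag (next s)) (sval (tagged (next s))).
pose s0 : st := existT (fun p => 'M[R]_(p.1, p.2)) (n, k0) d0.
split; apply: (@FreeResolution R G (fun i => (tag (iter i step s0)).1)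
  (fun i => tagged (iter i step s0)) f).
- by move=> y _; have : range f y by rewrite fT.
- exact: (rangeP _ _ _ _ d0E).
- by move=> i; exact: svalP (tagged (next (iter i step s0))).
Qed.

Variables (kappa : fieldType) (rho : {rmorphism R -> kappa}).
Hypothesis rho_surj : forall x, exists a, rho a = x.
Hypothesis rho_unit : forall a, rho a != 0 -> exists b, b * a = 1.

Lemma minimal_kernel_exists (N : lmodType R) n (f : {linear 'cV[R]_n -> N}) :
  exists r (A : 'M[R]_(n, r)),
    minimal_map rho (mulmx A) /\ range (mulmx A) = [set v | f v = 0].
Proof.
have [k [B BE]] := kernel_fg f.
have [r [g [g_min gE]]] := minimal_map_exists rho_unit (mulmx B).
have [|A gA] := @linear_factor R _ n r (mulmx 1%:M) g.
  by move=> _ [v _ <-]; exists (g v) => //=; rewrite mul1mx.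
have {}gA : g = mulmx A :> (_ -> _) by apply/funext => v; rewrite gA /= mul1mx.
by exists r, A; rewrite -gA gE.
Qed.

(** An arbitrary resolution is compared with a minimal presentation, which also gives the
    independence of Tor from the resolution in degrees 0 and 1. *)
Lemma tor_dimE (G : lmodType R) (F : free_resolution G) b r
    (f : {linear 'cV[R]_b -> G}) (A : 'M[R]_(b, r)) :
  minimal_map rho f -> range f = setT ->
  minimal_map rho (mulmx A) -> range (mulmx A) = [set v | f v = 0] ->
  tor_dim rho F 0 = b /\ tor_dim rho F 1 = r.
Proof.
move=> f_min fT A_min AE.
have augT : range (res_aug F) = range f.
  by rewrite fT; apply/seteqP; split=> // y _; exact: res_aug_surj.
have bE : (b + \rank (map_mx rho (res_diff F 0)))%N = res_rk F 0.
  apply: (minimal_syzygy_rank rho_surj rho_unit f_min augT).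
    by move=> v /res_exact0[w ->]; exists (map_mx rho w); rewrite map_mxM.
  move=> w; have [v <-] := mx_lift rho_surj w; exists (res_diff F 0 *m v).
    by apply/res_exact0; exists v.
  by rewrite map_mxM.
have [k [B [B_min BE]]] := minimal_kernel_exists (res_aug F).
have kE : (k + \rank (map_mx rho (res_diff F 1)))%N = res_rk F 1.
  apply: (minimal_syzygy_rank (s := mulmx (res_diff F 0)) rho_surj rho_unit B_min).
  - rewrite BE; apply/seteqP; split=> [_ [w _ <-]|v /= /res_exact0[w ->]].
      by apply/res_exact0; exists w.
    by exists w.
  - by move=> v /res_exactS[w ->]; exists (map_mx rho w); rewrite map_mxM.
  - move=> w; have [v <-] := mx_lift rho_surj w; exists (res_diff F 1 *m v).
      by apply/res_exactS; exists v.
    by rewrite map_mxM.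
(* With the names below, b + x = c, k + y = d and k + b = r + c, whence (d - x) - y = r. *)
have := minimal_kernel_rank rho_surj rho_unit f_min augT A_min AE B_min BE.
rewrite /tor_dim /= mxrank_ker mxrank_tr; move: bE kE.
set x := \rank (map_mx rho (res_diff F 0)); set y := \rank (map_mx rho (res_diff F 1)).
move: x y (res_rk F 0) (res_rk F 1) => x y c d; lia.
Qed.

(** [betti] selects a value by choice; the existence of a resolution ensures that this value is some
    [tor_dim], and all of these agree. *)
Lemma bettiE (G : lmodType R) b r
    (f : {linear 'cV[R]_b -> G}) (A : 'M[R]_(b, r)) :
  minimal_map rho f -> range f = setT ->
  minimal_map rho (mulmx A) -> range (mulmx A) = [set v | f v = 0] ->
  betti rho G 0 = b /\ betti rho G 1 = r.
Proof.
move=> f_min fT A_min AE; have [F0] := free_resolution_exists fT.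
have torE i : exists F : free_resolution G, betti rho G i = tor_dim rho F i.
  by apply: (@getPex nat [set b | exists F : free_resolution G, b = tor_dim rho F i]);
     exists (tor_dim rho F0 i), F0.
have [[F ->] [F' ->]] := (torE 0%N, torE 1%N).
by rewrite (tor_dimE F f_min fT A_min AE).1 (tor_dimE F' f_min fT A_min AE).2.
Qed.

End Noetherian.

(** * Consequences of completeness *)

Section AdicRing.
Variables (R : comNzRingType) (m : set R).
Variables (kappa : fieldType) (rho : {rmorphism R -> kappa}).
Hypothesis R_complete : adically_complete m.
Hypothesis rho_residue : residue_map m rho.

Lemma residue_surj x : exists a, rho a = x.
Proof. by have [rho_surj _] := rho_residue; have [a _ <-] := rho_surj x I; exists a. Qed.

Lemma residue_kerE a : m a <-> rho a = 0.
Proof. by have [_ ->] := rho_residue. Qed.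

Lemma ideal_pow_ideal k : is_ideal (ideal_pow m k).
Proof. by case: k => [//|k]; exact: ideal_gen_ideal. Qed.

Lemma ideal_powMl k a x : ideal_pow m k x -> ideal_pow m k (a * x).
Proof. by move=> mx; rewrite -[_ * _]addr0; apply: (ideal_pow_ideal k).2 (ideal_pow_ideal k).1. Qed.

Lemma ideal_powB k x y : ideal_pow m k x -> ideal_pow m k y -> ideal_pow m k (x - y).
Proof. by move=> mx my; rewrite addrC -mulN1r; apply: (ideal_pow_ideal k).2. Qed.

Lemma ideal_powSP k (P : set R) : is_ideal P ->
  (forall x y, m x -> ideal_pow m k y -> P (x * y)) -> ideal_pow m k.+1 `<=` P.
Proof. by move=> PI PM; apply: ideal_gen_sub => // _ [x [y [mx my ->]]]; exact: PM. Qed.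

Lemma ideal_pow_exp k y : m y -> ideal_pow m k (y ^+ k).
Proof.
move=> my; elim: k => [//|k IHk].
by apply: sub_ideal_gen; exists y, (y ^+ k); rewrite exprS.
Qed.

(** Both [x] and 0 are limits of the zero sequence, and limits are unique. *)
Lemma ideal_pow_sep x : (forall k, ideal_pow m k x) -> x = 0.
Proof.
move=> mx; have [k|l [_ l_uniq]] := R_complete (x := fun=> 0).
  by rewrite subrr; exact: (ideal_pow_ideal k).1.
rewrite -(l_uniq x) => [|k]; last by rewrite subr0.
by rewrite (l_uniq 0) // => k; rewrite subrr; exact: (ideal_pow_ideal k).1.
Qed.

(* The inverse is the sum of the geometric series.                             *)
Lemma complete_unit y : m y -> exists b, b * (1 - y) = 1.
Proof.
move=> my; have [k|b [bP _]] := R_complete (x := fun k => \sum_(i < k) y ^+ i).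
  by rewrite big_ord_recr /= addrAC subrr add0r; exact: ideal_pow_exp.
exists b; apply/eqP; rewrite -subr_eq0; apply/eqP/ideal_pow_sep => k.
have -> : b * (1 - y) - 1 = (1 - y) * (b - \sum_(i < k) y ^+ i) - y ^+ k.
  have -> : y ^+ k = (y - 1) * \sum_(i < k) y ^+ i + 1 by rewrite -subrX1 subrK.
  ring.
by apply: ideal_powB; [exact: ideal_powMl|exact: ideal_pow_exp].
Qed.

Lemma residue_unit a : rho a != 0 -> exists b, b * a = 1.
Proof.
move=> a0; have [c ca] := residue_surj (rho a)^-1.
have [|b bP] := @complete_unit (1 - c * a).
  by apply/residue_kerE; rewrite rmorphB rmorph1 rmorphM /= ca mulVf // subrr.
by exists (b * c); rewrite -mulrA; move: bP; rewrite subKr.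
Qed.

(* For [x] in the maximal ideal and [g != 0], the orbit of [x *: g] is smaller *)
(* than that of [g], so the exponent may be taken to be the order of [G].      *)
Lemma ideal_pow_annihilate (G : finLmodType R) :
  exists e, forall a (g : G), ideal_pow m e a -> a *: g = 0.
Proof.
pose orb (g : G) := [set h : G | `[< exists a, h = a *: g >]]%SET.
suff ann N g : (#|orb g| <= N)%N -> forall a, ideal_pow m N a -> a *: g = 0.
  by exists #|G| => a g; apply: ann; exact: max_card.
elim: N g => [|N IHN] g gN.
  have : g \in orb g by rewrite inE; apply/asboolP; exists 1; rewrite scale1r.
  by move: gN; rewrite leqn0 => /eqP/card0_eq ->.
apply: ideal_powSP => [|x y mx my].
  by split=> [|b c d cg dg]; rewrite ?scale0r // scalerDl -scalerA cg dg scaler0 addr0.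
have [->|g0] := eqVneq g 0; first by rewrite scaler0.
rewrite mulrC -scalerA; apply: IHN => //; rewrite -ltnS; apply: leq_trans gN.
apply: proper_card; apply/properP; split.
  apply/fintype.subsetP => h; rewrite !inE => -[a ->].
  by exists (a * x); rewrite scalerA.
exists g; rewrite inE; first by apply/asboolP; exists 1; rewrite scale1r.
apply/asboolP => -[a gE]; move/eqP: g0; apply.
(* If g = a x g, then 1 - a x, a unit, kills [g]. *)
have [|b bP] := @complete_unit (a * x).
  by apply/residue_kerE; rewrite rmorphM /= (residue_kerE x).1 ?mulr0.
by rewrite -[g]scale1r -bP -scalerA scalerBl scale1r -scalerA -gE subrr scaler0.
Qed.

End AdicRing.

(** * Counting in finite groups and over finite fields *)

Lemma card_hom_preimset (V W : finZmodType) (phi : V -> W) (S : {set W}) :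
  (forall x y, phi (x - y) = phi x - phi y) -> set_surj setT setT phi ->
  (#|[set v | phi v \in S]%SET| * #|W| = #|V| * #|S|)%N.
Proof.
move=> phiB phi_surj; pose c := #|[set v | phi v == 0]%SET|.
have fiber w : #|[set v | phi v == w]%SET| = c.
  have [v0 _ <-] := phi_surj w I.
  rewrite -[RHS](card_imset _ (addrI v0)); apply: eq_card => v.
  apply/idP/imsetP => [|[x + ->]]; rewrite !inE => /eqP vE.
    by exists (v - v0); [rewrite inE phiB vE subrr|rewrite addrC subrK].
  by have := phiB (v0 + x) x; rewrite addrK vE subr0 => <-.
have cardS (T : {set W}) : #|[set v | phi v \in T]%SET| = (#|T| * c)%N.
  rewrite -sum1_card (partition_big phi (mem T)) => [|v]; last by rewrite inE.
  rewrite -sum_nat_const; apply: eq_bigr => w wT; rewrite -(fiber w) -sum1_card.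
  by apply: eq_bigl => v; rewrite !inE andb_idl // => /eqP ->.
have := cardS [set: W]%SET; rewrite cardsT (_ : [set v | _]%SET = [set: V]%SET) ?cardsT => [->|].
  by rewrite cardS [RHS]mulnC -mulnA [(c * _)%N]mulnC.
by apply/setP => v; rewrite !inE.
Qed.

Lemma row_free_col_mx (F : fieldType) r k (u : 'rV[F]_k) (A : 'M[F]_(r, k)) :
  row_free (col_mx u A) = row_free A && ~~ (u <= A)%MS.
Proof.
rewrite -!row_leq_rank -addsmxE.
have [uA|uA] := boolP (u <= A)%MS.
  rewrite andbF (eqmx_rank (_ : u + A == A)%MS); last first.
    by rewrite addsmxSr addsmx_sub uA submx_refl.
  by apply/negbTE; rewrite -ltnNge ltnS rank_leq_row.
rewrite andbT.
have uAlt : (\rank A < \rank (u + A))%N.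
  apply: rank_ltmx; rewrite ltmxE addsmxSr /=; apply: contra uA => /(submx_trans _); apply.
  exact: addsmxSl.
have := leq_trans (mxrank_adds_leqif u A) (leq_add (rank_leq_row u) (leqnn _)).
by move=> uAle; apply/idP/idP; lia.
Qed.

Lemma card_submx (F : finFieldType) r k (A : 'M[F]_(r, k)) :
  row_free A -> #|[set u : 'rV_k | (u <= A)%MS]%SET| = (#|F| ^ r)%N.
Proof.
move=> /row_free_inj Ainj.
have <- : #|[set u *m A | u in [set: 'rV_r]%SET]%SET| = (#|F| ^ r)%N.
  by rewrite (card_imset _ (Ainj _)) cardsT card_mx mul1n.
apply: eq_card => u; rewrite inE; apply/submxP/imsetP => -[D].
  by move=> ->; exists D; rewrite ?inE.
by move=> _ ->; exists D.
Qed.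

(** The added first row must avoid the q^r vectors in the span of the others. *)
Lemma card_row_freeS (F : finFieldType) r k :
  #|[set Z : 'M[F]_(r.+1, k) | row_free Z]%SET| =
  (#|[set Z : 'M[F]_(r, k) | row_free Z]%SET| * (#|F| ^ k - #|F| ^ r))%N.
Proof.
pose col (p : 'M[F]_(r, k) * 'rV[F]_k) : 'M[F]_(1 + r, k) := col_mx p.2 p.1.
have col_bij : bijective col.
  exists (fun Z => (dsubmx Z, usubmx Z)) => [[A u]|Z] /=; rewrite /col /=.
    by rewrite col_mxKd col_mxKu.
  by rewrite vsubmxK.
rewrite -sum1_card -[X in (X * _)%N]sum1_card (reindex col) /=; last exact: onW_bij col_bij.
transitivity (\sum_(A : 'M[F]_(r, k) | row_free A)
    \sum_(u : 'rV[F]_k | ~~ (u <= A)%MS) 1)%N.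
  rewrite pair_big_dep; apply: eq_bigl => -[A u].
  by rewrite inE row_free_col_mx.
rewrite big_distrl /=; apply: eq_big => [A|A Afree]; first by rewrite inE.
rewrite mul1n -(card_submx Afree) sum1dep_card.
have -> : (#|F| ^ k = #|[set: 'rV[F]_k]%SET|)%N by rewrite cardsT card_mx mul1n.
rewrite -cardsDS; last by apply/fintype.subsetP => u; rewrite inE.
by apply: eq_card => u; rewrite !inE andbT.
Qed.

(** The recurrence gives the product of the q^k - q^i for i < r; take q^k out of each factor. *)
Lemma card_row_free (K : realFieldType) (F : finFieldType) r k : (r <= k)%N ->
  #|[set Z : 'M[F]_(r, k) | row_free Z]%SET|%:R =
  (#|F| ^ (r * k))%:R * \prod_((k - r).+1 <= i < k.+1) (1 - #|F|%:R ^- i) :> K.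
Proof.
have q0 : #|F|%:R != 0 :> K by rewrite pnatr_eq0 -lt0n (cardD1 0).
elim: r => [|r IHr] rk.
  rewrite subn0 big_geq // mulr1 mul0n expn0.
  rewrite (_ : [set Z | _]%SET = [set: 'M[F]_(0, k)]%SET) ?cardsT ?card_mx //.
  by apply/setP => Z; rewrite !inE /row_free flatmx0 mxrank0.
rewrite card_row_freeS natrM IHr ?(ltnW rk) // subnSK // [in RHS]big_ltn; last by lia.
rewrite natrB ?leq_pexp2l ?(ltnW rk) //; last by rewrite (cardD1 0).
rewrite mulSn addnC expnD natrM -!mulrA; congr (_ * _).
rewrite mulrC mulrA; congr (_ * _).
have -> : (#|F| ^ k = #|F| ^ r * #|F| ^ (k - r))%N by rewrite -expnD subnKC // ltnW.
by rewrite mulrBr mulr1 natrM; congr (_ - _); rewrite !natrX mulfK ?expf_neq0.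
Qed.

(** * Haar measure and finite quotients *)

(** The hypothesis says that the indicators of the [E i] with [i] in [P] sum to [N] times that of
    [A]; integrate. *)
Lemma measure_double_count d (T : measurableType d) (K : realType)
    (mu : {measure set T -> \bar K}) (I : finType) (P : {set I}) (E : I -> set T)
    (A : set T) (N : nat) :
  (forall i, measurable (E i)) -> measurable A ->
  (forall x, #|[set i in P | x \in E i]%SET| = if x \in A then N else 0%N) ->
  (\sum_(i in P) mu (E i) = N%:R%:E * mu A)%E.
Proof.
move=> mE mA EA.
under eq_bigr do rewrite -(setIT (E _)) -integral_indic //.
rewrite -big_enum -ge0_integral_sum //=; last first.
  by move=> i; apply/measurable_EFinP; exact: measurable_indic.
rewrite -[A in RHS]setIT -integral_indic // -ge0_integralZl_EFin //=; last first.
  by apply/measurable_EFinP; exact: measurable_indic.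
apply: eq_integral => x _; rewrite big_enum sumEFin -EFinM; congr EFin.
rewrite !indicE; under eq_bigr do rewrite indicE.
rewrite -natr_sum -natrM; congr _%:R.
transitivity #|[set i in P | x \in E i]%SET|; last by rewrite EA; case: ifP; rewrite ?muln1 ?muln0.
rewrite -sum1_card big_mkcond [RHS]big_mkcond; apply: eq_bigr => i _.
by rewrite finset.in_set; case: (i \in P); case: (x \in E i).
Qed.

Section HaarFibers.
Variables (R : comNzRingType) (m : set R) (n k : nat) (K : realType).
Variables (mu : probability (adic_borel m n k) K).
Hypothesis mu_haar : is_haar mu.
Variables (V : finZmodType) (H : set 'M[R]_(n, k)) (phi : 'M[R]_(n, k) -> V) (e : nat).
Hypothesis HB : forall X Y, H X -> H Y -> H (X - Y).
Hypothesis phiB : forall X Y, H X -> H Y -> phi (X - Y) = phi X - phi Y.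
Hypothesis phi_ker_open :
  forall X : 'M[R]_(n, k), (forall i j, ideal_pow m e (X i j)) -> H X /\ phi X = 0.

Lemma adic_measurable (U : set (adic_borel m n k)) : adic_open m U -> measurable U.
Proof. exact: sub_sigma_algebra. Qed.

Let H0 : H 0.
Proof.
have [|H00 _] := phi_ker_open (X := 0); last exact: H00.
move=> i j; rewrite mxE; case: e => [//|e']; exact: (ideal_gen_ideal _).1.
Qed.

Let HD X Y : H X -> H Y -> H (X + Y).
Proof. by move=> HX HY; rewrite -[Y]opprK; apply: (HB HX); rewrite -sub0r; exact: HB. Qed.

Let phiD X Y : H X -> H Y -> phi (X + Y) = phi X + phi Y.
Proof. by move=> HX HY; have := phiB (HD HX HY) HY; rewrite addrK => ->; rewrite subrK. Qed.

Lemma haar_measurable_preimset (S : {set V}) :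
  measurable ([set X : 'M[R]_(n, k) | H X /\ phi X \in S] : set (adic_borel m n k)).
Proof.
apply: adic_measurable => X [HX XS]; exists e => Y XY.
have [|HYX phi0] := phi_ker_open (X := Y - X); first by move=> i j; rewrite !mxE; apply: XY.
rewrite -(subrK X Y); split; first exact: HD.
by rewrite phiD // phi0 add0r.
Qed.

Hypothesis phi_surj : forall v, exists2 X, H X & phi X = v.

(** The fibres of [phi] in [H] are translates of each other, so they share [mu H] equally. [phi] is
    total, but it is required to be additive only on [H], which suits maps that are meaningful only
    there. *)
Lemma haar_preimset (S : {set V}) :
  mu [set X : 'M[R]_(n, k) | H X /\ phi X \in S] =
  ((#|S|%:R / #|V|%:R)%:E * mu (H : set (adic_borel m n k)))%E.
Proof.
pose F v : set (adic_borel m n k) := [set X : 'M[R]_(n, k) | H X /\ phi X \in [set v]%SET].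
have mF v : measurable (F v) by exact: haar_measurable_preimset.
have FE v : mu (F v) = mu (F 0).
  have [X HX Xv] := phi_surj v.
  rewrite -[RHS](mu_haar X (mF 0)); congr (mu _); apply/seteqP; split=> [Y [HY]|_ [Y [HY +] <-]].
    rewrite inE => /eqP Yv; exists (Y - X); last by rewrite addrC subrK.
    by split; [exact: HB|rewrite inE phiB // Yv Xv subrr].
  by rewrite inE => /eqP Y0; split; [exact: HD|rewrite inE phiD // Xv Y0 addr0].
have sumF (T : {set V}) :
    mu [set X : 'M[R]_(n, k) | H X /\ phi X \in T] = (#|T|%:R%:E * mu (F 0%R))%E.
  have := @measure_double_count _ _ _ mu V T F _ 1 mF (haar_measurable_preimset T).
  rewrite mul1e => <- => [|X].
    rewrite (eq_bigr (fun=> mu (F 0%R))) => [|v _]; last exact: FE.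
    by rewrite -[mu (F 0)]fineK ?fin_num_measure // sumEFin sumr_const -EFinM mulr_natl.
  have [HX|HX] := boolP (X \in _); [rewrite inE in HX|move/negP: HX => HX].
    rewrite -(cards1 (phi X)); apply: eq_card => v; rewrite finset.in_set finset.in_set1.
    apply/andP/eqP => [[_]|->]; first by rewrite inE => -[_]; rewrite finset.in_set1 => /eqP.
    by split; [exact: HX.2|rewrite inE; split; [exact: HX.1|rewrite finset.in_set1]].
  apply: eq_card0 => v; rewrite finset.in_set; apply/negbTE/negP => /andP[vT].
  by rewrite inE => -[HX1]; rewrite finset.in_set1 => /eqP Xv; apply: HX; rewrite inE /= Xv.
have -> : mu (H : set (adic_borel m n k)) = (#|V|%:R%:E * mu (F 0%R))%E.
  rewrite -cardsT -sumF; congr (mu _).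
  by apply/seteqP; split=> [X HX|X []//]; split; rewrite ?inE.
rewrite sumF -[mu (F 0)]fineK ?fin_num_measure // -!EFinM mulrA divfK //.
by rewrite pnatr_eq0 -lt0n; apply/card_gt0P; exists 0.
Qed.

End HaarFibers.

(** * Presentations, cokernels and automorphisms *)

Lemma range_section (T U : Type) (f : T -> U) :
  range f = setT -> {s : U -> T | cancel s f}.
Proof.
move=> fT; have fS y : exists v, f v = y.
  by have : range f y by [rewrite fT]; case=> v _ <-; exists v.
by have [s sE] := choice fS; exists s.
Qed.

Section Presentations.
Variables (R : comNzRingType) (N : lmodType R) (n : nat).

(** Encoding maps out of R^n by tuples lets those into a finite module range over a finite type. *)
Definition genmap (t : 'I_n -> N) (v : 'cV[R]_n) : N := \sum_i v i 0 *: t i.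

Lemma genmap_is_linear t : linear (genmap t).
Proof.
move=> a u v; rewrite /genmap scaler_sumr -big_split; apply: eq_bigr => i _.
by rewrite !mxE scalerDl scalerA.
Qed.

HB.instance Definition _ t :=
  GRing.isLinear.Build R 'cV[R]_n N *:%R (genmap t) (genmap_is_linear t).

Lemma genmap_delta t j : genmap t (delta_mx j 0) = t j.
Proof.
rewrite /genmap (bigD1 j) //= mxE !eqxx scale1r big1 ?addr0 // => i ij.
by rewrite mxE (negPf ij) scale0r.
Qed.

Lemma genmapE (f : {linear 'cV[R]_n -> N}) : genmap (fun j => f (delta_mx j 0)) =1 f.
Proof. by move=> v; rewrite (linear_cVE f). Qed.

Lemma eq_genmap t t' : t =1 t' -> genmap t =1 genmap t'.
Proof. by move=> tt' v; apply: eq_bigr => i _; rewrite tt'. Qed.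

Definition presents k (t : 'I_n -> N) (X : 'M[R]_(n, k)) : Prop :=
  range (genmap t) = setT /\ range (mulmx X) = [set v | genmap t v = 0].

End Presentations.

Section CokernelPresentations.
Local Open Scope quotient_scope.
Variables (R : comNzRingType) (n k : nat) (X : 'M[R]_(n, k)).

Definition cok_pi (v : 'cV[R]_n) : cok X := \pi_(cok X) v.

Lemma cok_pi_is_linear : linear cok_pi.
Proof. by move=> a u v; rewrite /cok_pi pi_addr; congr (_ + _); rewrite -pi_cok_scale. Qed.

HB.instance Definition _ :=
  GRing.isLinear.Build R 'cV[R]_n (cok X) *:%R cok_pi cok_pi_is_linear.

Lemma cok_pi_eq0 v : cok_pi v = 0 <-> exists w, v = X *m w.
Proof.
rewrite -(linear0 cok_pi) /cok_pi; split=> [/eqP|[w vE]].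
  by rewrite -Quotient.idealrBE subr0 => /asboolP.
by apply/eqP; rewrite -Quotient.idealrBE subr0; apply/asboolP; exists w.
Qed.

Lemma cok_pi_repr c : cok_pi (repr c) = c.
Proof. exact: reprK. Qed.

(** An isomorphism composed with the projection from R^n gives [t]; conversely, a surjection with
    kernel im X induces an isomorphism on the quotient. *)
Lemma cok_iso_presents (G : finLmodType R) :
  lmod_iso (cok X) G <-> exists t : {ffun 'I_n -> G}, presents t X.
Proof.
split=> [[f [g fK gK]]|[t [tT tX]]].
  pose h : {linear 'cV[R]_n -> G} := f \o cok_pi.
  exists [ffun j => h (delta_mx j 0)].
  have tE : genmap [ffun j => h (delta_mx j 0)] =1 h.
    by move=> v; rewrite -(genmapE h); apply: eq_genmap => j; rewrite ffunE.
  split; apply/seteqP; split=> //.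
  - by move=> y _; exists (repr (g y)) => //; rewrite tE /= cok_pi_repr gK.
  - by move=> _ [w _ <-] /=; rewrite tE /= (cok_pi_eq0 (X *m w)).2 ?linear0 //; exists w.
  - move=> v /=; rewrite tE /= -(linear0 f) => /(can_inj fK)/cok_pi_eq0[w ->].
    by exists w.
have [s sE] := range_section tT.
have tX0 v : genmap t v = 0 <-> cok_pi v = 0.
  transitivity ([set v | genmap t v = 0] v) => //; rewrite -tX cok_pi_eq0.
  by split=> [[w _ <-]|[w ->]]; exists w.
pose f (c : cok X) := genmap t (repr c).
have fE v : f (cok_pi v) = genmap t v.
  apply/eqP; rewrite -subr_eq0 -linearB; apply/eqP/tX0.
  by rewrite linearB /= cok_pi_repr subrr.
have f_lin : linear f.
  move=> a c d; rewrite -(cok_pi_repr c) -(cok_pi_repr d) -linearP !fE.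
  exact: linearP.
pose F : {linear cok X -> G} := HB.pack f (GRing.isLinear.Build _ _ _ _ f f_lin).
exists F; exists (cok_pi \o s) => [c|y] /=; last by rewrite fE sE.
apply/eqP; rewrite -subr_eq0 -[X in _ - X]cok_pi_repr -linearB; apply/eqP/tX0.
by rewrite linearB /= sE subrr.
Qed.

(** Composition with [t] is injective on automorphisms since [t] is onto, and reaches every
    surjection with the same kernel. *)
Lemma card_presents (G : finLmodType R) (t : {ffun 'I_n -> G}) : presents t X ->
  #|[set t' : {ffun 'I_n -> G} | `[< presents t' X >]]%SET| = #|lmod_Aut G|.
Proof.
move=> [tT tX].
have [s sE] := range_section tT.
pose h (p : {perm G}) := [ffun i => p (t i)].
have hE (p : {perm G}) : p \in lmod_Aut G -> genmap (h p) =1 p \o genmap t.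
  rewrite inE => /asboolP p_lin v.
  pose P : {linear G -> G} :=
    HB.pack (p : G -> G) (GRing.isLinear.Build _ _ _ _ (p : G -> G) p_lin).
  rewrite /= -[RHS]/(P _) linear_sum; apply: eq_bigr => i _.
  by rewrite linearZ ffunE.
have aut0 (p : {perm G}) : p \in lmod_Aut G -> p 0 = 0.
  rewrite inE => /asboolP p_lin.
  by have := p_lin (-1) 0 0; rewrite scaler0 addr0 scaleN1r addNr.
have h_inj : {in lmod_Aut G &, injective h}.
  move=> p p' pA p'A pp'; apply/permP => y; rewrite -(sE y).
  by have := hE p pA (s y); rewrite pp' hE.
rewrite -(card_in_imset h_inj); apply: eq_card => t'; rewrite finset.in_set.
apply/asboolP/imsetP => [[t'T t'X]|[p pA ->]].
  have tt' v : genmap t v = 0 <-> genmap t' v = 0.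
    transitivity ([set v | genmap t v = 0] v) => //.
    transitivity ([set v | genmap t' v = 0] v) => //.
    by rewrite -tX -t'X.
  (* The automorphism carrying [t] to [t']; equality of the kernels makes it independent of the
     section [s]. *)
  pose q y := genmap t' (s y).
  have qE v : q (genmap t v) = genmap t' v.
    apply/eqP; rewrite -subr_eq0 -linearB; apply/eqP/tt'.
    by rewrite linearB /= sE subrr.
  have q_lin : linear q.
    by move=> a y z; rewrite -(sE y) -(sE z) -linearP !qE; exact: linearP.
  have q_inj : injective q.
    move=> y z /eqP; rewrite -subr_eq0 -linearB => /eqP/tt'; rewrite linearB /= !sE.
    by move/eqP; rewrite subr_eq0 => /eqP.
  exists (perm q_inj).
    rewrite finset.in_set; apply/asboolP => a y z; rewrite !permE; exact: q_lin.
  by apply/ffunP => i; rewrite ffunE permE -(genmap_delta t) qE genmap_delta.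
split; apply/seteqP; split=> //.
- move=> y _; exists (s ((p^-1)%g y)) => //.
  by rewrite (hE _ pA) /= sE permKV.
- by move=> v; rewrite tX /= (hE _ pA) /= => ->; exact: aut0.
- move=> v; rewrite tX /= (hE _ pA) /= => pv0; apply: (@perm_inj _ p).
  by rewrite pv0 aut0.
Qed.

End CokernelPresentations.

(** Makes tuples of elements of [G] a finite group, as [card_hom_preimset] requires. *)
HB.instance Definition _ (I : finType) (V : finZmodType) := Finite.on {ffun I -> V}.

(** * Generation tested on reductions *)

Section MinimalGeneration.
Variables (R : comNzRingType) (kappa : fieldType) (rho : {rmorphism R -> kappa}).
Hypothesis rho_surj : forall x, exists a, rho a = x.
Hypothesis rho_unit : forall a, rho a != 0 -> exists b, b * a = 1.
Variables (N : lmodType R) (r : nat) (g : {linear 'cV[R]_r -> N}).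
Hypothesis g_min : minimal_map rho g.

(** By minimality the reduction of [v] depends only on [g v]. Off the range of [g], [eta] takes the
    default value 0. *)
Lemma minimal_reduction : exists eta : N -> 'cV[kappa]_r,
  forall v, eta (g v) = map_mx rho v.
Proof.
have etaP y : exists x, forall v, g v = y -> x = map_mx rho v.
  have [[w gw]|noy] := pselect (exists w, g w = y).
    exists (map_mx rho w) => v gv; apply/eqP; rewrite -subr_eq0 -raddfB; apply/eqP.
    by apply: g_min; rewrite linearB /= gw gv subrr.
  by exists 0 => v gv; case: noy; exists v.
by have [eta etaE] := choice etaP; exists eta => v; exact: etaE.
Qed.

Lemma minimal_range_rank k (s : {linear 'cV[R]_k -> N}) (eta : N -> 'cV[kappa]_r) :
  (forall v, eta (g v) = map_mx rho v) -> range s `<=` range g ->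
  range s = range g <-> \rank (\matrix_(i, j) eta (s (delta_mx j 0)) i 0) = r.
Proof.
move=> etaE /linear_factor[Z sZ].
rewrite (_ : \matrix_(i, j) _ = map_mx rho Z); last first.
  by apply/matrixP => i j; rewrite mxE sZ etaE -colE !mxE.
exact: minimal_factor_rank.
Qed.

Lemma minimal_rank_le k (s : {linear 'cV[R]_k -> N}) : range s = range g -> (r <= k)%N.
Proof.
move=> sg; have [eta etaE] := minimal_reduction.
have [|/(_ sg) rE _] := @minimal_range_rank k s eta etaE; first by rewrite sg.
by rewrite -[X in (X <= _)%N]rE rank_leq_col.
Qed.

Lemma range_extend k (f : {linear 'cV[R]_r -> N}) : (r <= k)%N ->
  range (fun v : 'cV[R]_k => f (pid_mx r *m v)) = range f.
Proof.
move=> rk; apply/seteqP; split=> [_ [v _ <-]|_ [v _ <-]]; first by exists (pid_mx r *m v).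
exists (pid_mx r *m v) => //=; rewrite mulmxA mul_pid_mx.
by rewrite minnn (minn_idPr rk) pid_mx_1 mul1mx.
Qed.

End MinimalGeneration.

(** * Existence, number and probability of presentations *)

Section Cokernels.
Variables (R : comNzRingType) (m : set R) (kappa : finFieldType).
Variable rho : {rmorphism R -> kappa}.
Hypothesis R_noetherian : noetherian R.
Hypothesis R_complete : adically_complete m.
Hypothesis rho_residue : residue_map m rho.
Variables (G : finLmodType R) (b r0 : nat).
Variables (f0 : {linear 'cV[R]_b -> G}) (A0 : 'M[R]_(b, r0)).
Hypothesis f0_min : minimal_map rho f0.
Hypothesis f0_surj : range f0 = setT.
Hypothesis A0_min : minimal_map rho (mulmx A0).
Hypothesis A0E : range (mulmx A0) = [set v | f0 v = 0].

Let rho_surj := residue_surj rho_residue.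
Let rho_unit := residue_unit R_complete rho_residue.

(** The kernel of a surjection R^n -> G needs r = r0 + n - b generators, so [k] columns can generate
    it iff r <= k. *)
Lemma presents_existsP n k :
  (exists X : 'M[R]_(n, k), exists t : {ffun 'I_n -> G}, presents t X) <->
  (b <= n)%N /\ (r0 + n <= b + k)%N.
Proof.
split=> [[X [t [tT tX]]]|[bn rk]].
  have tf0 : range (genmap t) = range f0 by rewrite tT.
  split; first exact: (minimal_rank_le rho_surj rho_unit f0_min tf0).
  have [r [A [A_min AE]]] := minimal_kernel_exists R_noetherian rho_unit (genmap t).
  have := minimal_kernel_rank rho_surj rho_unit f0_min tf0 A0_min A0E A_min AE.
  have := minimal_rank_le rho_surj rho_unit A_min (etrans tX (esym AE)); lia.
(* The minimal generators of [G] padded with zeros; [A] is padded by zero columns in the same way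
   below. *)
pose f : {linear 'cV[R]_n -> G} := f0 \o mulmx (pid_mx b).
have tf0 : range f = range f0 by exact: range_extend.
have [r [A [A_min AE]]] := minimal_kernel_exists R_noetherian rho_unit f.
have rE := minimal_kernel_rank rho_surj rho_unit f0_min tf0 A0_min A0E A_min AE.
have tE : genmap [ffun j => f (delta_mx j 0)] =1 f.
  by move=> v; rewrite -[RHS]genmapE; apply: eq_genmap => j; rewrite ffunE.
exists (A *m pid_mx r), [ffun j => f (delta_mx j 0)]; split.
  by rewrite (funext tE) tf0.
rewrite (funext tE) -AE -(range_extend (mulmx A) (k := k)); last lia.
by congr (_ @` _); apply/funext => v; rewrite -mulmxA.
Qed.

(** Reducing coordinates on the minimal generators maps G^n homomorphically onto the b x n matrices
    over [kappa], and a tuple generates [G] iff its image has rank [b]. *)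
Lemma card_generators (K : realFieldType) n : (b <= n)%N ->
  #|[set t : {ffun 'I_n -> G} | `[< range (genmap t) = setT >]]%SET|%:R =
  #|G|%:R ^+ n * \prod_((n - b).+1 <= j < n.+1) (1 - #|kappa|%:R ^- j) :> K.
Proof.
move=> bn; have [eta etaE] := minimal_reduction f0_min.
have [s sE] := range_section f0_surj.
pose phi (t : {ffun 'I_n -> G}) : 'M[kappa]_(b, n) := \matrix_(i, j) eta (t j) i 0.
have phiB t t' : phi (t - t') = phi t - phi t'.
  apply/matrixP => i j; rewrite !mxE !ffunE.
  rewrite -[t j]sE -[t' j]sE.
  by rewrite -linearB !etaE !mxE rmorphB.
have phi_surj : set_surj setT setT phi.
  move=> Z _; have [Y <-] := mx_lift rho_surj Z.
  exists [ffun j => f0 (col j Y)] => //; apply/matrixP => i j.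
  by rewrite !mxE ffunE etaE !mxE.
have := card_hom_preimset [set Z | row_free Z]%SET phiB phi_surj.
rewrite card_ffun card_ord card_mx => /(congr1 (fun i : nat => i%:R : K)).
rewrite !natrM (card_row_free K _ bn) mulrCA => /(canRL (mulfK _)).
have q0 : (#|kappa| ^ (b * n))%:R != 0 :> K.
  by rewrite pnatr_eq0 -lt0n expn_gt0 (cardD1 0).
rewrite mulrC mulKf // => /(_ q0); rewrite natrX => <-; congr _%:R; apply: eq_card => t.
rewrite !finset.in_set.
have [|rankP rankP'] := minimal_range_rank rho_surj rho_unit f0_min (s := genmap t) etaE.
  by rewrite f0_surj.
have phiE : phi t = \matrix_(i, j) eta (genmap t (delta_mx j 0)) i 0.
  by apply/matrixP => i j; rewrite !mxE genmap_delta.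
rewrite /row_free phiE; apply/asboolP/eqP; first by rewrite -f0_surj.
by move=> /rankP' ->.
Qed.

Section Haar.
Variables (n k : nat) (K : realType) (mu : probability (adic_borel m n k) K).
Hypothesis mu_haar : is_haar mu.

(* The columns of [X] lie in the kernel of [t] with probability [|G| ^- k]; the *)
(* reduction of their coordinates on minimal generators of that kernel is then *)
(* uniform over the residue field, and they generate when it has full rank.    *)
Lemma haar_presents (t : {ffun 'I_n -> G}) :
  let E : set (adic_borel m n k) := [set X : 'M[R]_(n, k) | presents t X] in
  measurable E /\
  (range (genmap t) = setT -> (r0 + n <= b + k)%N ->
   mu E = ((#|G|%:R ^+ k)^-1 *
     \prod_((b + k - r0 - n).+1 <= i < k.+1) (1 - #|kappa|%:R ^- i))%:E).
Proof.
move=> E.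
have [tT|tT] := pselect (range (genmap t) = setT); last first.
  split=> //; rewrite (_ : E = set0) //; apply/seteqP; split=> // X [].
  by [].
have [r [A [A_min AE]]] := minimal_kernel_exists R_noetherian rho_unit (genmap t).
have tf0 : range (genmap t) = range f0 by rewrite tT.
have rE := minimal_kernel_rank rho_surj rho_unit f0_min tf0 A0_min A0E A_min AE.
have [eta etaE] := minimal_reduction A_min.
have [e eG] := ideal_pow_annihilate R_complete rho_residue G.
have kerA v : genmap t v = 0 <-> exists w, v = A *m w.
  transitivity ([set v | genmap t v = 0] v) => //; rewrite -AE.
  by split=> [[w _ <-]|[w ->]]; exists w.
pose H : set 'M[R]_(n, k) := [set X | forall j, genmap t (col j X) = 0].
pose phi (X : 'M[R]_(n, k)) : 'M[kappa]_(r, k) := \matrix_(i, j) eta (col j X) i 0.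
have HB X Y : H X -> H Y -> H (X - Y).
  by move=> HX HY j; rewrite linearB /= linearB /= HX HY subrr.
have phiB X Y : H X -> H Y -> phi (X - Y) = phi X - phi Y.
  move=> HX HY; apply/matrixP => i j; rewrite !mxE linearB.
  have [[v /= ->] [w /= ->]] := ((kerA _).1 (HX j), (kerA _).1 (HY j)).
  by rewrite -mulmxBr !etaE !mxE rmorphB.
have powG (v : 'cV[R]_n) : (forall i, ideal_pow m e (v i 0)) -> genmap t v = 0.
  by move=> ve; apply: big1 => i _; apply: eG.
(* The exponent is [e.+1] because m^e R^n only lies in ker t; one more factor from [m] places it in
   m ker t, where coordinates on [A] reduce to 0. *)
have pow_delta i a : ideal_pow m e.+1 a ->
    exists2 w : 'cV_r, a *: delta_mx i 0 = A *m w & map_mx rho w = 0.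
  move: a; apply: ideal_powSP => [|x y mx my].
    split; first by exists 0; rewrite ?scale0r ?mulmx0 ?raddf0.
    move=> a x y [v xv v0] [w yw w0]; exists (a *: v + w).
      by rewrite scalerDl -scalerA xv yw mulmxDr scalemxAr.
    by rewrite raddfD /= w0 addr0 map_mxZ v0 scaler0.
  have /kerA[w wE] : genmap t (y *: delta_mx i 0) = 0.
    apply: powG => i'; rewrite !mxE mulrC; exact: ideal_powMl.
  exists (x *: w); first by rewrite -scalerA wE scalemxAr.
  by rewrite map_mxZ ((residue_kerE rho_residue x).1 mx) scale0r.
have pow_cV (v : 'cV[R]_n) : (forall i, ideal_pow m e.+1 (v i 0)) ->
    exists2 w : 'cV_r, v = A *m w & map_mx rho w = 0.
  move=> ve; rewrite {1}(matrix_sum_delta v).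
  have /choice[w wP] i : exists w : 'cV_r, v i 0 *: delta_mx i 0 = A *m w /\ map_mx rho w = 0.
    by have [w ? ?] := pow_delta i _ (ve i); exists w.
  exists (\sum_i w i); last by rewrite raddf_sum big1 // => i _; exact: (wP i).2.
  by rewrite mulmx_sumr; apply: eq_bigr => i _; rewrite big_ord1 (wP i).1.
have phi_open (X : 'M[R]_(n, k)) : (forall i j, ideal_pow m e.+1 (X i j)) -> H X /\ phi X = 0.
  move=> Xe; have Xj j : exists2 w : 'cV_r, col j X = A *m w & map_mx rho w = 0.
    by apply: pow_cV => i; rewrite mxE.
  split=> [j|]; first by have [w XE _] := Xj j; apply/kerA; exists w.
  apply/matrixP => i j; rewrite !mxE; have [w -> w0] := Xj j.
  by rewrite etaE w0 mxE.
have EE : E = [set X : 'M[R]_(n, k) | H X /\ phi X \in [set Z | row_free Z]%SET].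
  have sA X : H X -> range (mulmx X : 'cV_k -> 'cV_n) `<=` range (mulmx A).
    move=> HX _ [v _ <-]; have [w ->] : exists w, X *m v = A *m w; last by exists w.
    apply: (kerA _).1; rewrite [LHS](linear_cVE (genmap t \o mulmx X)) big1 // => j _.
    by rewrite /= -colE HX scaler0.
  have gen_rank X : H X ->
      range (mulmx X : 'cV_k -> 'cV_n) = range (mulmx A) <-> row_free (phi X).
    move=> HX; rewrite (minimal_range_rank rho_surj rho_unit A_min etaE (sA X HX)).
    rewrite (_ : \matrix_(i, j) _ = phi X); first by split=> /eqP.
    by apply/matrixP => i j; rewrite [LHS]mxE [RHS]mxE /= -colE.
  apply/seteqP; split=> X; rewrite /E /= /presents -AE finset.in_set.
    move=> [_ XA]; have HX : H X.
      move=> j; apply/kerA; have : range (mulmx X) (col j X).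
        by exists (delta_mx j 0); rewrite // colE.
      by rewrite XA => -[w _ <-]; exists w.
    by split=> //; apply/(gen_rank X HX).
  by move=> [HX /(gen_rank X HX)].
(* [H] is the kernel of this homomorphism onto G^k, hence has measure |G|^-k. *)
pose psi (X : 'M[R]_(n, k)) : 'rV[G]_k := \row_j genmap t (col j X).
have psiB X Y : setT X -> setT Y -> psi (X - Y) = psi X - psi Y.
  by move=> _ _; apply/rowP => j; rewrite !mxE !linearB.
have psi_open (X : 'M[R]_(n, k)) : (forall i j, ideal_pow m e (X i j)) -> setT X /\ psi X = 0.
  by move=> Xe; split=> //; apply/rowP => j; rewrite !mxE powG // => i; rewrite mxE.
have HE : H = [set X : 'M[R]_(n, k) | setT X /\ psi X \in [set 0]%SET].
  apply/seteqP; split=> [X HX|X [_]].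
    by split=> //; rewrite finset.in_set1; apply/eqP/rowP => j; rewrite !mxE HX.
  by rewrite finset.in_set1 => /eqP/rowP X0 j; have := X0 j; rewrite !mxE.
split; first by rewrite EE; exact: haar_measurable_preimset HB phiB phi_open _.
move=> _ rk.
have psi_surj v : exists2 X, setT X & psi X = v.
  have [s sE] := range_section tT; exists (\matrix_(i, j) s (v 0 j) i 0) => //.
  apply/rowP => j; rewrite mxE -[RHS]sE; congr (genmap t _).
  by apply/matrixP => i l; rewrite !mxE ord1.
have phi_surj Z : exists2 X, H X & phi X = Z.
  have [Y <-] := mx_lift rho_surj Z; exists (A *m Y).
    by move=> j; apply/kerA; exists (col j Y); rewrite colE -mulmxA -colE.
  by apply/matrixP => i j; rewrite !mxE colE -mulmxA -colE etaE !mxE.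
have muH : mu (H : set (adic_borel m n k)) = ((#|G|%:R ^+ k)^-1)%:E.
  have := haar_preimset mu_haar (fun _ _ _ _ => I) psiB psi_open psi_surj [set 0]%SET.
  rewrite -HE => ->; rewrite (_ : mu _ = 1)%E; last exact: probability_setT.
  by rewrite mule1 cards1 card_mx mul1n natrX mul1r.
rewrite EE (haar_preimset mu_haar HB phiB phi_open phi_surj) muH -EFinM; congr EFin.
have rk' : (r <= k)%N by lia.
have q0 : (#|kappa| ^ (r * k))%:R != 0 :> K.
  by rewrite pnatr_eq0 -lt0n expn_gt0 (cardD1 0).
rewrite (card_row_free K _ rk') card_mx [X in X / _]mulrC mulfK // mulrC.
by rewrite (_ : b + k - r0 - n = k - r)%N //; lia.
Qed.

End Haar.
End Cokernels.

(** * Summation over the surjections *)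

Theorem theorem3p1 (R : comNzRingType) (m : set R) (kappa : finFieldType)
    (rho : {rmorphism R -> kappa})
    (R_noetherian : noetherian R) (R_local : local_ring m)
    (R_complete : adically_complete m) (rho_residue : residue_map m rho)
    (u n : nat) (n_gt0 : (0 < n)%N) (G : finLmodType R) :
  let b0 := betti rho G 0%N in
  let b1 := betti rho G 1%N in
  ((exists X : 'M[R]_(n, n + u), lmod_iso (cok X) G) <->
     (b0 <= n)%N /\ (b1 <= b0 + u)%N) /\
  forall (K : realType) (mu : probability (adic_borel m n (n + u)) K),
    is_haar mu ->
    let E : set (adic_borel m n (n + u)) :=
      [set X : 'M[R]_(n, n + u) | lmod_iso (cok X) G] in
    let q : K := #|kappa|%:R in
    measurable E /\
    mu E =
      (if (b0 <= n)%N && (b1 <= b0 + u)%N then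
         (#|lmod_Aut G|%:R * #|G|%:R ^+ u)^-1
         * \prod_((u + b0 - b1).+1 <= i < (n + u).+1) (1 - q ^- i)
         * \prod_((n - b0).+1 <= j < n.+1) (1 - q ^- j)
       else 0)%:E.
Proof.
have rho_surj := residue_surj rho_residue.
have rho_unit := residue_unit R_complete rho_residue.
(* All elements of [G] generate it; a minimal system comes from this one. *)
have [b [f0 [f0_min f0E]]] :=
  minimal_map_exists rho_unit (genmap (fun i : 'I_#|G| => enum_val i : G)).
have f0_surj : range f0 = setT.
  rewrite f0E; apply/seteqP; split=> // y _; exists (delta_mx (enum_rank y) 0) => //.
  by rewrite /= genmap_delta enum_rankK.
have [r0 [A0 [A0_min A0E]]] := minimal_kernel_exists R_noetherian rho_unit f0.
have [-> ->] := bettiE R_noetherian rho_surj rho_unit f0_min f0_surj A0_min A0E.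
move=> b0 b1; have condP :
    (exists X : 'M[R]_(n, n + u), lmod_iso (cok X) G) <-> (b0 <= n)%N /\ (b1 <= b0 + u)%N.
  have [presP presP'] := presents_existsP R_noetherian R_complete rho_residue
    f0_min f0_surj A0_min A0E n (n + u).
  split=> [[X /cok_iso_presents Xt]|[bn bu]].
    by have [|bn bu] := presP; [exists X|split=> //; rewrite /b0 /b1; lia].
  have [|X Xt] := presP' _; first by split=> //; move: bu; rewrite /b0 /b1; lia.
  by exists X; apply/cok_iso_presents.
split=> // K mu mu_haar E q.
have [/andP cond|cond] := ifPn; last first.
  have -> : E = set0.
    apply/seteqP; split=> // X EX; move/negP: cond; apply; apply/andP.
    by apply/condP; exists X.
  by split; [exact: measurable0|exact: measure0].
have [bn bu] := cond.
pose Et (t : {ffun 'I_n -> G}) : set (adic_borel m n (n + u)) :=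
  [set X : 'M[R]_(n, n + u) | presents t X].
pose P := [set t : {ffun 'I_n -> G} | `[< range (genmap t) = setT >]]%SET.
have EtP t := haar_presents R_noetherian R_complete rho_residue f0_min f0_surj A0_min A0E mu_haar t.
have EE : E = \bigcup_t Et t.
  apply/seteqP; split=> [X /cok_iso_presents[t tX]|X [t _ tX]]; first by exists t.
  by apply/cok_iso_presents; exists t.
have mE : measurable E.
  rewrite EE; apply: fin_bigcup_measurable => [|t _]; first exact: finite_finset.
  exact: (EtP t).1.
split=> //.
have count : (\sum_(t in P) mu (Et t) = #|lmod_Aut G|%:R%:E * mu E)%E.
  apply: measure_double_count => // [t|X]; first exact: (EtP t).1.
  have setE : [set t in P | X \in Et t]%SET = [set t : {ffun 'I_n -> G} | `[< presents t X >]]%SET.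
    apply/setP => t; rewrite !finset.in_set; apply/andP/asboolP.
      by move=> [_]; rewrite inE.
    by move=> tX; split; [apply/asboolP; exact: tX.1|rewrite inE].
  rewrite setE; have [XE|XE] := boolP (X \in E).
    by move: XE; rewrite inE => /cok_iso_presents[t tX]; exact: card_presents tX.
  apply: eq_card0 => t; rewrite finset.in_set; apply/asboolP => tX; move/negP: XE; apply.
  by rewrite inE; apply/cok_iso_presents; exists t.
have Aut0 : #|lmod_Aut G|%:R != 0 :> K.
  rewrite pnatr_eq0 -lt0n; apply/card_gt0P; exists 1%g.
  by rewrite finset.in_set; apply/asboolP => a x y; rewrite !perm1.
have G0 : #|G|%:R != 0 :> K by rewrite pnatr_eq0 -lt0n; apply/card_gt0P; exists 0.
(* The common value of [mu (Et t)] for [t] in [P]. *)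
pose c := (#|G|%:R ^+ (n + u))^-1 *
  \prod_((u + b0 - b1).+1 <= i < (n + u).+1) (1 - q ^- i).
move: count; rewrite (eq_bigr (fun=> c%:E)) => [|t]; last first.
  rewrite finset.in_set => /asboolP tT.
  rewrite (EtP t).2 //; last by move: bu; rewrite /b0 /b1; lia.
  by rewrite /c /b0 /b1 (_ : b + (n + u) - r0 - n = u + b - r0)%N //; lia.
rewrite sumEFin sumr_const -[c *+ _]mulr_natl /P.
(* The factor |G|^n of this count cancels against |G|^-(n+u) in [c], leaving |G|^-u. *)
rewrite (card_generators R_complete rho_residue f0_min f0_surj) //.
rewrite -[mu E]fineK ?fin_num_measure // -EFinM => -[] cE; congr EFin.
apply: (mulfI Aut0); rewrite -cE /c exprD !invfM.
by field; rewrite Aut0 !expf_neq0.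
Qed.
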